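(* Let $p$ be an odd prime, $n\ge 1$, $i\ge 1$, and $B=R_{n,i}^{\,p}$. The normalized derivation satisfies $$\delta_i^{\,p}=B^{p-1}\delta_i$$ on $D_n$ and on $D_n[Q_{n,0}^{-1}]$. Consequently, for every integer $m\ge 1$, $$\delta_i^{\,m+p-1}=B^{p-1}\delta_i^{\,m}.$$ In particular, $B=0$ implies $\delta_i^p=0$, whereas $B=1$ implies $\delta_i^p=\delta_i$.
   Context: Let $p$ be an odd prime, $n\ge 1$, $i\ge 1$, and $P_n=\mathbb{F}_p[x_1,\dots,x_n]$. For integers $e_1,\dots,e_n\ge 0$ put $[e_1,\dots,e_n]:=\det\big(x_r^{p^{e_s}}\big)_{1\le r,s\le n}\in P_n$. Let $L_n=[0,1,\dots,n-1]$ and $L_{n,s}=[0,1,\dots,\widehat{s},\dots,n]$ for $0\le s<n$ (a hat means omission). The Dickson invariants are $Q_{n,s}=L_{n,s}/L_n$ $(0\le s<n)$; in particular $Q_{n,0}=L_n^{p-1}$. The Dickson algebra is $D_n=P_n^{\mathrm{GL}_n(\mathbb{F}_p)}=\mathbb{F}_p[Q_{n,0},\dots,Q_{n,n-1}]$, a polynomial algebra on these generators. $\mathrm{St}^{\Delta_i}$ denotes the Steenrod--Milnor operation dual to the monomial $\xi_i$ in Milnor's dual mod-$p$ Steenrod algebra. It acts on $P_n$ as the unique $\mathbb{F}_p$-linear derivation with $\mathrm{St}^{\Delta_i}(x_r)=x_r^{p^i}$ $(1\le r\le n)$, and it maps $D_n$ into $D_n$. On a localization of $D_n$, $\mathrm{St}^{\Delta_i}$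 means the unique derivation extending $\mathrm{St}^{\Delta_i}|_{D_n}$. Set $R_{n,i}:=\dfrac{[0,1,\dots,n-2,i-1]}{L_n}$ (for $n=1$, $R_{1,i}=[i-1]/L_1$); it lies in $D_n$. The normalized derivation is $\delta_i:=(-1)^nQ_{n,0}^{-1}\mathrm{St}^{\Delta_i}$ on $D_n[Q_{n,0}^{-1}]$; it maps $D_n$ into $D_n$. Powers of operators denote iterated composition. *)

(* Defs.v *)
From HB Require Import structures.
From mathcomp Require Import all_boot all_order all_algebra all_field.
From mathcomp Require Import mpoly ring.

Set Implicit Arguments.
Unset Strict Implicit.
Unset Printing Implicit Defensive.

Import GRing.Theory.
Local Open Scope ring_scope.
Local Open Scope quotient_scope.

Notation "x %:F" := (FracField.tofrac x) : ring_scope.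

(* Additive with the Leibniz rule; over 'F_p, linearity is automatic. *)
Definition derivation (R : comNzRingType) (d : R -> R) : Prop :=
  {morph d : a b / a + b} /\ forall a b, d (a * b) = d a * b + a * d b.

(* The quotient rule, read on the chosen representative of [z];
   [frac_der_div] shows that the choice is irrelevant. *)
Definition frac_der (R : idomainType) (d : R -> R) (z : {fraction R}) :
    {fraction R} :=
  let a := \n_(repr z) in let b := \d_(repr z) in
  (d a * b - a * d b)%:F / b%:F ^+ 2.

Section Derivations.

Lemma derivation0 (R : comNzRingType) (d : R -> R) : derivation d -> d 0 = 0.
Proof. by case=> dD _; apply: (@addrI _ (d 0)); rewrite -dD !addr0. Qed.

Lemma derivation1 (R : comNzRingType) (d : R -> R) : derivation d -> d 1 = 0.
Proof.
case=> _ dM; apply: (@addrI _ (d 1)).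
by rewrite addr0 -{3}[1]mulr1 dM mulr1 mul1r.
Qed.

Lemma frac_repr (R : idomainType) (z : {fraction R}) :
  z = (\n_(repr z))%:F / (\d_(repr z))%:F.
Proof.
have nz : (\d_(repr z))%:F != 0 :> {fraction R}.
  by rewrite tofrac_eq0 denom_ratioP.
apply: (mulIf nz); rewrite divfK //.
have -> : z * (\d_(repr z))%:F =
  \pi_{fraction R} (FracField.mulf (repr z) (Ratio (\d_(repr z)) 1)).
  rewrite FracField.pi_mul reprK; congr (_ * _).
  by unlock FracField.tofrac.
unlock FracField.tofrac; apply/eqmodP; rewrite /= FracField.equivfE.
rewrite /FracField.mulf !numden_Ratio ?mulf_neq0 ?oner_neq0 ?denom_ratioP //.
by rewrite !mulr1 mulrC.
Qed.

Variables (R : idomainType) (d : R -> R).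
Hypothesis dP : derivation d.

Lemma frac_der_div a b : b != 0 ->
  frac_der d (a%:F / b%:F) = (d a * b - a * d b)%:F / b%:F ^+ 2.
Proof.
move=> b0; rewrite /frac_der; set z := a%:F / b%:F.
have e0 := denom_ratioP (repr z); have := frac_repr z.
move: (\n_(repr z)) (\d_(repr z)) e0 => c e e0; rewrite {}/z.
have bF : b%:F != 0 :> {fraction R} by rewrite tofrac_eq0.
have eF : e%:F != 0 :> {fraction R} by rewrite tofrac_eq0.
move=> /eqP; rewrite eqr_div // -!tofracM tofrac_eq => /eqP ae.
case: dP => _ dM.
have dae : d a * e + a * d e = d c * b + c * d b by rewrite -!dM ae.
apply/eqP; rewrite eqr_div ?expf_neq0 // -!tofracXn -!tofracM tofrac_eq.
apply/eqP.
have -> : (d a * b - a * d b) * e ^+ 2 =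
    (d a * e + a * d e) * b * e - (a * e) * (b * d e + d b * e) by ring.
by rewrite dae ae; ring.
Qed.

Lemma frac_der_tofrac a : frac_der d a%:F = (d a)%:F.
Proof.
rewrite -[X in frac_der d X]divr1 -[X in _ / X]tofrac1 frac_der_div ?oner_neq0 //.
by rewrite (derivation1 dP) mulr0 subr0 mulr1 tofrac1 expr1n divr1.
Qed.

Lemma frac_der_derivation : derivation (frac_der d).
Proof.
have addE (F : fieldType) (a b c e da db dc de : F) : b != 0 -> e != 0 ->
    ((da * e + a * de + (dc * b + c * db)) * (b * e)
       - (a * e + c * b) * (db * e + b * de)) / (b * e) ^+ 2
    = (da * b - a * db) / b ^+ 2 + (dc * e - c * de) / e ^+ 2.
  by move=> b0 e0; field; rewrite b0 e0.
have mulE (F : fieldType) (a b c e da db dc de : F) : b != 0 -> e != 0 ->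
    ((da * c + a * dc) * (b * e) - (a * c) * (db * e + b * de)) / (b * e) ^+ 2
    = (da * b - a * db) / b ^+ 2 * (c / e)
      + a / b * ((dc * e - c * de) / e ^+ 2).
  by move=> b0 e0; field; rewrite b0 e0.
have [dD dM] := dP.
have F0 (z : {fraction R}) : (\d_(repr z))%:F != 0 :> {fraction R}.
  by rewrite tofrac_eq0 denom_ratioP.
split=> u v; have := (F0 u, F0 v);
  have := (denom_ratioP (repr u), denom_ratioP (repr v));
  move: (frac_repr u) (frac_repr v);
  move: (\n_(repr u)) (\d_(repr u)) (\n_(repr v)) (\d_(repr v))
    => a b c e -> -> [b0 e0] [bF eF].
- rewrite addf_div // -!tofracM -!tofracD !frac_der_div ?mulf_neq0 // !dD !dM.
  by rewrite !(tofracB, tofracD, tofracM) addE.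
- rewrite mulf_div -!tofracM !frac_der_div ?mulf_neq0 // !dM.
  by rewrite !(tofracB, tofracD, tofracM) mulE.
Qed.

End Derivations.

Section Dickson.

Variables (p n : nat).
Local Notation P := {mpoly 'F_p[n]}.

Definition bracket (e : 'I_n -> nat) : P :=
  \det (\matrix_(r < n, s < n) (('X_r : P) ^+ (p ^ e s)%N)).

Definition bracketL : P := bracket (fun j => j : nat).

(* [fun j => bump s j] enumerates 0, .., n with s omitted. *)
Definition bracketL_hat (s : nat) : P := bracket (fun j => bump s j).

(* Q_{n,s} and R_{n,i} are formed as quotients, so they are elements of the
   fraction field; polynomials are identified with fractions through %:F. *)
Definition dicksonQ (s : nat) : {fraction P} := (bracketL_hat s)%:F / bracketL%:F.

(* R_{n,i}, with exponents 0, .., n-2, i-1; meant for n, i >= 1. *)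
Definition dicksonR (i : nat) : {fraction P} :=
  (bracket (fun j => if j == n.-1 :> nat then i.-1 else j))%:F / bracketL%:F.

Definition lin_subst (g : 'M['F_p]_n) (f : P) : P :=
  f \mPo [tuple \sum_(s < n) g s r *: 'X_s | r < n].

(* The Dickson algebra D_n, as the invariants of GL_n('F_p). *)
Definition dickson (f : P) : Prop :=
  forall g : 'M['F_p]_n, g \in unitmx -> lin_subst g f = f.

(* D_n[Q_{n,0}^-1], as a subring of the fraction field. *)
Definition dickson_loc (z : {fraction P}) : Prop :=
  exists2 f, dickson f & exists k, z = f%:F / dicksonQ 0 ^+ k.

(* St^{Delta_i} on polynomials; see [steenrod_derivation], [steenrodX] and
   [steenrod_unique]. *)
Definition steenrod (i : nat) (f : P) : P :=
  \sum_(r < n) f^`M(r) * 'X_r ^+ (p ^ i)%N.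

(* Its extension to fractions; on D_n[Q_{n,0}^-1] this is the unique derivation
   extending the restriction of [steenrod i] to D_n ([steenrod_loc_unique]). *)
Definition steenrod_frac (i : nat) : {fraction P} -> {fraction P} :=
  frac_der (steenrod i).

(* The normalized derivation (-1)^n Q_{n,0}^-1 St^{Delta_i}. *)
Definition delta (i : nat) (z : {fraction P}) : {fraction P} :=
  (-1) ^+ n * (dicksonQ 0)^-1 * steenrod_frac i z.

Definition eq_on_dickson (d1 d2 : {fraction P} -> {fraction P}) : Prop :=
  forall f : P, dickson f -> d1 f%:F = d2 f%:F.

Definition eq_on_dickson_loc (d1 d2 : {fraction P} -> {fraction P}) : Prop :=
  forall z, dickson_loc z -> d1 z = d2 z.

Lemma steenrod_derivation i : derivation (steenrod i).
Proof.
split=> a b; rewrite /steenrod.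
- by rewrite -big_split; apply: eq_bigr => r _; rewrite mderivD mulrDl.
- rewrite mulr_suml mulr_sumr -big_split; apply: eq_bigr => r _ /=.
  by rewrite mderivM; ring.
Qed.

Lemma steenrodX i (r : 'I_n) : steenrod i 'X_r = 'X_r ^+ (p ^ i).
Proof.
rewrite /steenrod (bigD1 r) //= big1 ?addr0 => [|s sr].
  rewrite mderivX mnm1E eqxx scale1r (_ : (U_(r) - U_(r))%MM = 0%MM).
    by rewrite mpolyX0 mul1r.
  by apply/mnmP=> j; rewrite mnmBE mnm0E subnn.
by rewrite mderivX mnm1E eq_sym (negPf sr) scale0r mul0r.
Qed.

(* Two sigma-derivations agreeing on scalars and variables agree. *)
Lemma sderivation_ext (s d1 d2 : P -> P) :
  {morph d1 : a b / a + b} -> {morph d2 : a b / a + b} ->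
  (forall a b, d1 (a * b) = d1 a * s b + s a * d1 b) ->
  (forall a b, d2 (a * b) = d2 a * s b + s a * d2 b) ->
  (forall c, d1 c%:MP = d2 c%:MP) -> (forall r, d1 'X_r = d2 'X_r) ->
  d1 =1 d2.
Proof.
move=> d1D d2D d1M d2M eC eX.
have eM a b : d1 a = d2 a -> d1 b = d2 b -> d1 (a * b) = d2 (a * b).
  by move=> ea eb; rewrite d1M d2M ea eb.
have e1 : d1 1 = d2 1 by rewrite -mpolyC1.
elim/mpolyind => [|c m f _ _ ih]; first by rewrite -mpolyC0.
rewrite d1D d2D ih -mul_mpolyC; congr (_ + _); apply: (eM) => //.
rewrite mpolyXE_id; apply: (big_ind (fun g => d1 g = d2 g)) => [||r _].
- exact: e1.
- exact: eM.
- by elim: (m r) => // k IH; rewrite exprS; apply: (eM).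
Qed.

Lemma derivationC (d : P -> P) c : prime p -> derivation d -> d c%:MP = 0.
Proof.
move=> p_pr dP; have [dD _] := dP.
have {1}-> : c = (c : nat)%:R by rewrite natr_Zp.
rewrite mpolyC_nat; elim: (c : nat) => [|k IH]; first exact: derivation0.
by rewrite mulrS dD IH (derivation1 dP) addr0.
Qed.

Lemma steenrod_unique i (d : P -> P) : prime p -> derivation d ->
  (forall r, d 'X_r = 'X_r ^+ (p ^ i)) -> d =1 steenrod i.
Proof.
move=> p_pr dP dX; have sP := steenrod_derivation i.
apply: (@sderivation_ext id); try by [case: dP | case: sP].
- by move=> c; rewrite !derivationC.
- by move=> r; rewrite dX steenrodX.
Qed.

Section Prime.

Hypothesis p_pr : prime p.

Lemma pcharP : p \in [pchar P].
Proof. by rewrite inE p_pr -mpolyC_nat pchar_Fp_0 // mpolyC0 eqxx. Qed.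

Lemma Fp_expp (c : 'F_p) : c ^+ p = c.
Proof. by have := expf_card c; rewrite card_Fp. Qed.

Lemma Fp_exppX (c : 'F_p) k : c ^+ (p ^ k) = c.
Proof. by elim: k => // k IH; rewrite expnS exprM Fp_expp. Qed.

Lemma mpoly_sum_exppX (I : finType) (F : I -> P) k :
  (\sum_j F j) ^+ (p ^ k) = \sum_j F j ^+ (p ^ k).
Proof.
have p0 : (0 < p ^ k)%N by rewrite expn_gt0 prime_gt0.
elim/big_rec2: _ => [|j a b _ <-]; first by rewrite expr0n gtn_eqF.
by rewrite exprDn_pchar // pnatX (pnatE _ p_pr) pcharP.
Qed.

Lemma lin_substX g r : lin_subst g 'X_r = \sum_s g s r *: 'X_s.
Proof. by rewrite /lin_subst comp_mpolyXU -tnth_nth tnth_mktuple. Qed.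

Lemma steenrod_lin_subst i g f :
  steenrod i (lin_subst g f) = lin_subst g (steenrod i f).
Proof.
have [sD sM] := steenrod_derivation i.
pose lg := lin_subst g; have lgE : lg = lin_subst g by [].
move: f; apply: (@sderivation_ext lg) => [a b|a b|a b|a b|c|r].
- by rewrite /lin_subst raddfD sD.
- by rewrite sD /lin_subst raddfD.
- by rewrite /lg /lin_subst rmorphM sM.
- by rewrite sM /lg /lin_subst rmorphD !rmorphM.
- rewrite /lin_subst comp_mpolyC !(derivationC _ p_pr (steenrod_derivation i)).
  by rewrite raddf0.
- rewrite steenrodX {2}/lin_subst rmorphXn /= -/(lin_subst g 'X_r) !lin_substX.
  rewrite mpoly_sum_exppX (big_morph _ sD (derivation0 (steenrod_derivation i))).
  apply: eq_bigr => s _; rewrite -!mul_mpolyC sM steenrodX.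
  rewrite (derivationC _ p_pr (steenrod_derivation i)) mul0r add0r exprMn.
  by rewrite -rmorphXn /= Fp_exppX.
Qed.

Lemma dickson1 : dickson 1.
Proof. by move=> g _; rewrite /lin_subst rmorph1. Qed.

Lemma dicksonB f1 f2 : dickson f1 -> dickson f2 -> dickson (f1 - f2).
Proof. by move=> h1 h2 g gu; rewrite -{2}(h1 g gu) -{2}(h2 g gu) /lin_subst rmorphB. Qed.

Lemma dicksonM f1 f2 : dickson f1 -> dickson f2 -> dickson (f1 * f2).
Proof. by move=> h1 h2 g gu; rewrite -{2}(h1 g gu) -{2}(h2 g gu) /lin_subst rmorphM. Qed.

Lemma dicksonX f k : dickson f -> dickson (f ^+ k).
Proof.
move=> hf; elim: k => [|k IH]; first exact: dickson1.
by rewrite exprS; apply: dicksonM.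
Qed.

Lemma dickson_steenrod i f : dickson f -> dickson (steenrod i f).
Proof. by move=> hf g gu; rewrite -steenrod_lin_subst hf. Qed.

Lemma lin_subst_bracket g e : lin_subst g (bracket e) = \det g *: bracket e.
Proof.
rewrite /bracket /lin_subst -det_map_mx -[in RHS]det_tr -mul_mpolyC -det_map_mx.
rewrite -det_mulmx; congr (\det _); apply/matrixP => r s; rewrite !mxE.
rewrite rmorphXn /= -/(lin_subst _ _) lin_substX mpoly_sum_exppX.
apply: eq_bigr => t _; rewrite !mxE -mul_mpolyC exprMn.
by rewrite -rmorphXn /= Fp_exppX.
Qed.

Lemma bracketL_hat0 : bracketL_hat 0 = bracketL ^+ p.
Proof.
rewrite -(pFrobenius_autE pcharP) /bracketL /bracket -det_map_mx.
congr (\det _); apply/matrixP => r s; rewrite !mxE /= pFrobenius_autE.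
by rewrite -exprM /bump leq0n add1n expnSr.
Qed.

Lemma dicksonQ0E : dicksonQ 0 = (bracketL ^+ p.-1)%:F.
Proof.
rewrite /dicksonQ bracketL_hat0.
have [->|L0] := eqVneq bracketL 0.
  have p1 : p.-1 != 0%N by rewrite -lt0n -ltnS prednK ?prime_gt0 ?prime_gt1.
  by rewrite tofrac0 invr0 mulr0 expr0n (negPf p1) tofrac0.
have -> : bracketL ^+ p = bracketL ^+ p.-1 * bracketL.
  by rewrite -exprSr prednK ?prime_gt0.
by rewrite tofracM mulfK ?tofrac_eq0.
Qed.

Lemma dickson_Q0 : dickson (bracketL ^+ p.-1).
Proof.
move=> g gu; rewrite /lin_subst rmorphXn /= -/(lin_subst g bracketL) lin_subst_bracket.
have g0 : \det g != 0 by rewrite -unitfE -unitmxE.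
have e1 : \det g ^+ p.-1 = 1.
  apply: (mulIf g0); rewrite -exprSr prednK ?prime_gt0 // mul1r.
  exact: Fp_expp.
by rewrite exprZn e1 scale1r.
Qed.

Lemma dickson_loc_steenrod i z : dickson_loc z -> dickson_loc (steenrod_frac i z).
Proof.
have sP := steenrod_derivation i.
case=> f hf [k ->]; rewrite dicksonQ0E -tofracXn; set q := _ ^+ k.
have hq : dickson q by apply/dicksonX/dickson_Q0.
have [q0|q0] := eqVneq q 0.
  rewrite q0 rmorph0 invr0 mulr0 -tofrac0 /steenrod_frac frac_der_tofrac //.
  rewrite (derivation0 sP); exists 0; last by exists 0; rewrite expr0 divr1.
  by rewrite -(subrr f); apply: dicksonB.
rewrite /steenrod_frac frac_der_div //.
exists (steenrod i f * q - f * steenrod i q).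
  by apply: dicksonB; apply: dicksonM => //; apply: dickson_steenrod.
by exists (k * 2)%N; rewrite dicksonQ0E -!tofracXn /q exprM.
Qed.

Lemma steenrod_frac_derivation i : derivation (steenrod_frac i).
Proof. exact: frac_der_derivation (steenrod_derivation i). Qed.

Lemma steenrod_loc_unique i (d : {fraction P} -> {fraction P}) :
  (forall z w, dickson_loc z -> dickson_loc w -> d (z * w) = d z * w + z * d w) ->
  eq_on_dickson d (steenrod_frac i) ->
  eq_on_dickson_loc d (steenrod_frac i).
Proof.
move=> dM dE z zloc; have [f hf [k zE]] := zloc.
have [_ sM] := steenrod_frac_derivation i.
move: zE; rewrite dicksonQ0E -tofracXn; set q := _ ^+ k => zE.
have hq : dickson q by apply/dicksonX/dickson_Q0.
have [q0|q0] := eqVneq q 0.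
  rewrite zE q0 rmorph0 invr0 mulr0 -tofrac0; apply: dE.
  by rewrite -(subrr f); apply: dicksonB.
have qF : q%:F != 0 :> {fraction P} by rewrite tofrac_eq0.
have qloc : dickson_loc q%:F by exists q => //; exists 0; rewrite expr0 divr1.
have fE : f%:F = z * q%:F by rewrite zE divfK.
apply: (mulIf qF); apply: (addIr (z * d q%:F)).
by rewrite -dM // (dE q) // -sM -fE dE.
Qed.

End Prime.

End Dickson.

Arguments delta p n i z : clear implicits.

(* Main.v *)
Require Import Defs.
From HB Require Import structures.
From mathcomp Require Import all_boot all_order all_algebra all_field.
From mathcomp Require Import mpoly.

(** In characteristic [p] the iterate [delta^p] is again a derivation, so it is
    enough to compare it with [B^(p-1) delta] on the variables.  Put
    [c = (-1)^n / Q_{n,0}], so that [delta x_r = c x_r^(p^i)].  Expanding the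
    determinant [L_n] along its first column, the only one which the operation
    does not kill, gives [St L_n = (-1)^(n-1) [0,..,n-2,i-1]^p], that is
    [delta L_n = - B L_n], whence [delta c = - B c].  As [delta] kills [p]-th
    powers, [delta^p x_r = (- B)^(p-1) c x_r^(p^i) = B^(p-1) delta x_r].  The
    identity therefore holds on the whole fraction field. *)

Set Implicit Arguments.
Unset Strict Implicit.
Unset Printing Implicit Defensive.

Import GRing.Theory.
Local Open Scope ring_scope.

(** * Derivations of commutative rings: powers, iterates, characteristic [p] *)

Section DerivationRing.

Variables (R : comNzRingType) (d : R -> R).
Hypothesis dP : derivation d.

Lemma derivation_sum (I : Type) (r : seq I) (F : I -> R) :
  d (\sum_(j <- r) F j) = \sum_(j <- r) d (F j).
Proof. exact: (big_morph d (proj1 dP) (derivation0 dP)). Qed.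

Lemma derivationN a : d (- a) = - d a.
Proof.
apply: (@addrI _ (d a)); rewrite subrr -(proj1 dP) subrr.
exact: derivation0.
Qed.

Lemma derivationMn a k : d (a *+ k) = d a *+ k.
Proof.
elim: k => [|k IH]; first by rewrite !mulr0n (derivation0 dP).
by rewrite !mulrS (proj1 dP) IH.
Qed.

Lemma derivationXn a k : d (a ^+ k) = a ^+ k.-1 * d a *+ k.
Proof.
case: k => [|k] /=; first by rewrite expr0 mulr0n (derivation1 dP).
elim: k => [|k IH]; first by rewrite expr0 mul1r.
rewrite exprS (proj2 dP) IH -mulrnAr mulrA -exprS mulrnAr [RHS]mulrS.
by rewrite [d a * _]mulrC.
Qed.

Lemma derivationMsign a k : d ((-1) ^+ k * a) = (-1) ^+ k * d a.
Proof.
by elim: k => [|k IH]; rewrite ?mul1r // exprS !mulN1r !mulNr derivationN IH.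
Qed.

Lemma derivation_pchar_exp p a : p \in [pchar R] -> d (a ^+ p) = 0.
Proof. by move=> pR; rewrite derivationXn mulrn_pchar. Qed.

Lemma derivation_scale c : derivation (fun a => c * d a).
Proof.
split=> a b; first by rewrite (proj1 dP) mulrDr.
by rewrite (proj2 dP) mulrDr mulrA mulrCA.
Qed.

(** As [a] is a constant of [d], each application just contributes one more factor [a]. It serves
    below with the eigenvalue [- B]. *)
Lemma iter_derivation_eigen a c k :
  d a = 0 -> d c = a * c -> iter k d c = a ^+ k * c.
Proof.
move=> da dc; elim: k => [|k IH]; first by rewrite mul1r.
rewrite iterS IH (proj2 dP) derivationXn da mulr0 mul0rn mul0r add0r.
by rewrite dc mulrA -exprSr.
Qed.

Lemma iter_derivationM m a b :
  iter m d (a * b) = \sum_(k < m.+1) iter (m - k) d a * iter k d b *+ 'C(m, k).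
Proof.
elim: m => [|m IH]; first by rewrite big_ord1.
rewrite iterS IH derivation_sum.
under eq_bigr => k _ do
  rewrite derivationMn (proj2 dP) -!iterS mulrnDl -subSn -1?ltnS //.
(* The product rule yields two sums. Once the extreme terms are split off, the remaining ones pair
   up by Pascal's rule. *)
rewrite big_split big_ord_recl [RHS]big_ord_recl /= !bin0 -addrA; congr (_ + _).
rewrite [in RHS]big_ord_recr big_ord_recr /= addrA subSS; congr (_ + _); last first.
  by rewrite !binn.
rewrite -big_split; apply: eq_bigr => k _ /=.
by rewrite /bump leq0n add1n subSS binS mulrnDr.
Qed.

(* Only the two extreme binomial coefficients survive modulo [p]. *)
Lemma derivation_iter_pchar p : p \in [pchar R] -> derivation (iter p d).
Proof.
move=> pR; have p_pr := pcharf_prime pR; split=> a b.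
  by elim: p {pR p_pr} => //= k ->; rewrite (proj1 dP).
rewrite iter_derivationM (bigD1 ord0) // (bigD1 ord_max) /=; last first.
  by rewrite -lt0n prime_gt0.
rewrite big1 ?addr0 => [|k /andP[k0 km]].
  by rewrite subn0 subnn bin0 binn.
have kp : (0 < k < p)%N.
  by rewrite lt0n k0 ltn_neqAle -ltnS ltn_ord andbT.
rewrite -mulr_natr; apply/eqP; rewrite (_ : 'C(p, k)%:R = 0) ?mulr0 //.
by apply/eqP; rewrite -(dvdn_pcharf pR) prime_dvd_bin.
Qed.

End DerivationRing.

Section DerivationField.

Variables (K : fieldType) (d : K -> K).
Hypothesis dP : derivation d.

Lemma derivationV a : d a^-1 = - (a^-1 ^+ 2 * d a).
Proof.
have [->|a0] := eqVneq a 0; first by rewrite invr0 (derivation0 dP) mulr0 oppr0.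
apply: (mulIf a0); apply/eqP; rewrite -subr_eq0 mulNr opprK expr2 -!mulrA.
rewrite [d a * a]mulrC mulKf // -(proj2 dP) mulVf //.
by rewrite (derivation1 dP).
Qed.

End DerivationField.

(** * Derivations of the fraction field and their values on the variables *)

Section FractionDerivations.

Variables (p n : nat).
Local Notation P := {mpoly 'F_p[n]}.
Local Notation K := {fraction P}.

Hypothesis p_pr : prime p.

Lemma pchar_fraction : p \in [pchar K].
Proof.
have := pcharP n p_pr; rewrite !inE => /andP[-> /eqP p0] /=.
by rewrite -(rmorph_nat (@FracField.tofrac P)) p0 rmorph0.
Qed.

(** Scalars of the prime field are multiples of 1, so agreement on the variables spreads to
    monomials and polynomials by the product rule, and to fractions by [derivationV]. *)
Lemma fraction_derivation_ext (d1 d2 : K -> K) :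
  derivation d1 -> derivation d2 ->
  (forall r : 'I_n, d1 ('X_r)%:F = d2 ('X_r)%:F) -> d1 =1 d2.
Proof.
move=> d1P d2P eX.
have eM a b : d1 a = d2 a -> d1 b = d2 b -> d1 (a * b) = d2 (a * b).
  by move=> ea eb; rewrite (proj2 d1P) (proj2 d2P) ea eb.
have e1 : d1 1 = d2 1 by rewrite !derivation1.
have eF (f : P) : d1 f%:F = d2 f%:F.
  elim/mpolyind: f => [|c m f _ _ IH]; first by rewrite tofrac0 !derivation0.
  rewrite tofracD (proj1 d1P) (proj1 d2P) IH -mul_mpolyC tofracM.
  congr (_ + _); apply: (eM).
    have -> : c = (c : nat)%:R by rewrite natr_Zp.
    by rewrite !rmorph_nat !derivationMn // e1.
  rewrite mpolyXE_id; apply: (big_ind (fun g : P => d1 g%:F = d2 g%:F)).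
  - by rewrite tofrac1.
  - by move=> a b; rewrite tofracM; apply: eM.
  - move=> r _; elim: (m r) => [|k IHk]; first by rewrite expr0 tofrac1.
    by rewrite exprS tofracM; apply: eM.
move=> z; rewrite (frac_repr z); apply: (eM) => //.
by rewrite !derivationV // eF.
Qed.

End FractionDerivations.

(** * The operation on [L_n], and the [p]-th iterate of [delta] *)

Section Steenrod.

Variables (p n : nat).
Local Notation P := {mpoly 'F_p[n.+1]}.
Local Notation K := {fraction P}.

Hypothesis p_pr : prime p.

(* Both sides are expansions of the determinant with exponents [1, .., n, i]: along
   its first column, [i] being moved there, and along its last one. *)
Lemma steenrod_bracketL i : (0 < i)%N ->
  steenrod i (bracketL p n.+1) =
  (-1) ^+ n * bracket p (fun j : 'I_n.+1 => if j == n :> nat then i.-1 else j) ^+ p.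
Proof.
move=> i0; have sP := @steenrod_derivation p n.+1 i.
set e := fun j : 'I_n.+1 => _.
have pP := pcharP n.+1 p_pr.
rewrite -(pFrobenius_autE pP) /bracketL /bracket -det_map_mx.
set M := \matrix_(r, s) _; set N := \matrix_(r, s) _.
have NE r s : map_mx (pFrobenius_aut pP) N r s = 'X_r ^+ (p ^ (e s).+1).
  by rewrite !mxE pFrobenius_autE -exprM expnSr.
(* Columns 1, .., n of [M] are the Frobenius images of columns 0, .., n-1 of [N]. *)
have minor r : row' r (col' ord0 M) =
    map_mx (pFrobenius_aut pP) (row' r (col' ord_max N)).
  apply/matrixP=> s t; rewrite !mxE pFrobenius_autE -exprM -expnSr /e.
  by rewrite /= /bump leq0n add1n leqNgt ltn_ord add0n ltn_eqF.
rewrite (expand_det_col M ord0) (expand_det_col _ ord_max) derivation_sum //.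
rewrite mulr_sumr; apply: eq_bigr => r _.
rewrite NE /e eqxx prednK // (proj2 sP) /cofactor (derivationMsign sP).
rewrite -map_col' -map_row' -minor.
rewrite [X in steenrod i X]mxE expn0 expr1 steenrodX minor det_map_mx /=.
(* The minors are [p]-th powers, so only the entry of the first column gets differentiated. *)
rewrite pFrobenius_autE (derivation_pchar_exp sP) // !mulr0 addr0 addn0.
rewrite [RHS]mulrCA; congr (_ * _); rewrite mulrA -exprD.
(* The cofactor sign of the last column supplies a second [(-1)^n], which cancels the first. *)
by rewrite addnCA addnn -muln2 exprD exprM sqrr_sign mulr1.
Qed.

Lemma delta_derivation i : derivation (delta p n.+1 i).
Proof. exact/derivation_scale/frac_der_derivation/steenrod_derivation. Qed.

Lemma delta_tofrac i (f : P) :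
  delta p n.+1 i f%:F = (-1) ^+ n.+1 * (dicksonQ p n.+1 0)^-1 * (steenrod i f)%:F.
Proof.
by rewrite /delta /steenrod_frac frac_der_tofrac //; apply: steenrod_derivation.
Qed.

(** Since [Q_{n,0} = L^(p-1)], dividing [b^p] by it gives [(b/L)^p L]; the two signs multiply to
    -1. *)
Lemma delta_bracketL i : (0 < i)%N ->
  delta p n.+1 i (bracketL p n.+1)%:F =
  - (dicksonR p n.+1 i ^+ p * (bracketL p n.+1)%:F).
Proof.
move=> i0; have dP := delta_derivation i.
have [->|L0] := eqVneq (bracketL p n.+1) 0.
  by rewrite tofrac0 (derivation0 dP) mulr0 oppr0.
have LF : (bracketL p n.+1)%:F != 0 :> K by rewrite tofrac_eq0.
rewrite delta_tofrac steenrod_bracketL // /dicksonR dicksonQ0E //=.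
move: (bracket _ _) (bracketL _ _) LF => b L LF.
rewrite tofracM !tofracXn tofracN tofrac1 exprS mulN1r !mulNr; congr (- _).
rewrite mulrACA -expr2 sqrr_sign mul1r expr_div_n -mulrA mulrC; congr (_ * _).
have -> : L%:F ^+ p = L%:F ^+ p.-1 * L%:F by rewrite -exprSr prednK ?prime_gt0.
by rewrite invfM mulfVK.
Qed.

Lemma iter_delta_prime i (z : K) : odd p -> (0 < i)%N ->
  iter p (delta p n.+1 i) z =
  dicksonR p n.+1 i ^+ p ^+ (p - 1) * delta p n.+1 i z.
Proof.
move=> p_odd i0; have dP := delta_derivation i; have pK := pchar_fraction n.+1 p_pr.
have dB : delta p n.+1 i (- dicksonR p n.+1 i ^+ p) = 0.
  by rewrite derivationN // derivation_pchar_exp ?oppr0.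
have dL := delta_bracketL i0.
move: z; apply: fraction_derivation_ext => // [||r].
- exact: derivation_iter_pchar.
- exact: derivation_scale.
set d := delta _ _ _ in dP dB dL *; set B := _ ^+ p in dB dL *.
set c : K := (-1) ^+ n.+1 * (dicksonQ p n.+1 0)^-1.
(* From [d L = - B L] follows [d (L^(p-1)) = - (p-1) B L^(p-1) = B L^(p-1)], and inverting changes
   the sign. *)
have dc : d c = - B * c.
  have mulrn_pred (x : K) : x *+ p.-1 = - x.
    apply: (@addrI _ x); rewrite -mulrS prednK ?prime_gt0 // subrr.
    exact: mulrn_pchar.
  rewrite /c (derivationMsign dP) (derivationV dP) dicksonQ0E // tofracXn.
  rewrite (derivationXn dP) dL mulrn_pred !mulrN opprK.
  rewrite mulNr [in RHS]mulrCA; congr (- (_ * _)).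
  rewrite (mulrCA _ B) (mulrCA _ B); congr (_ * _); rewrite -exprSr.
  have p2 : (0 < p.-1)%N by rewrite -ltnS prednK ?prime_gt0 ?prime_gt1.
  rewrite prednK //; set q := _ ^+ p.-1.
  have [->|q0] := eqVneq q 0; first by rewrite invr0 !mulr0.
  by rewrite expr2 mulfVK.
have dX : d ('X_r)%:F = c * ('X_r ^+ (p ^ i))%:F.
  by rewrite /d delta_tofrac steenrodX.
(* For [i > 0] this is a [p]-th power, so later iterates act on [c] alone. *)
have dY : d ('X_r ^+ (p ^ i))%:F = 0.
  rewrite -(prednK i0) expnSr exprM tofracXn; exact: derivation_pchar_exp.
have dXk k : iter k.+1 d ('X_r)%:F = iter k d c * ('X_r ^+ (p ^ i))%:F.
  elim: k => [|k IH] //; rewrite iterS IH (proj2 dP) dY mulr0 addr0 //.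
rewrite -[p in iter p](prednK (prime_gt0 p_pr)) dXk.
rewrite (iter_derivation_eigen dP _ dB dc) subn1 dX -mulrA; congr (_ * _).
(* The sign [(-1)^(p-1)] is 1 because [p] is odd. *)
rewrite exprNn -signr_odd -[odd _]negbK -oddS prednK ?prime_gt0 // p_odd.
by rewrite mul1r.
Qed.

End Steenrod.

Theorem proposition2p14 (p n i : nat) (p_prime : prime p) (p_odd : odd p)
    (n_ge1 : (1 <= n)%N) (i_ge1 : (1 <= i)%N) :
  let B : {fraction {mpoly 'F_p[n]}} := dicksonR p n i ^+ p in
  let d := delta p n i in
  [/\ eq_on_dickson (iter p d) (fun z => B ^+ (p - 1) * d z) /\
      eq_on_dickson_loc (iter p d) (fun z => B ^+ (p - 1) * d z),
      forall m : nat, (1 <= m)%N ->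
        eq_on_dickson (iter (m + p - 1) d)
          (fun z => B ^+ (p - 1) * iter m d z) /\
        eq_on_dickson_loc (iter (m + p - 1) d)
          (fun z => B ^+ (p - 1) * iter m d z),
      B = 0 ->
        eq_on_dickson (iter p d) (fun=> 0) /\
        eq_on_dickson_loc (iter p d) (fun=> 0)
    & B = 1 ->
        eq_on_dickson (iter p d) d /\ eq_on_dickson_loc (iter p d) d].
Proof.
have key z :
    iter p (delta p n i) z = dicksonR p n i ^+ p ^+ (p - 1) * delta p n i z.
  by case: n n_ge1 z => // n' _ z; apply: iter_delta_prime.
move=> B d; rewrite -/B -/d in key.
(* Applying [key] to the iterate of order [m - 1] leaves [B^(p-1)] outside every [d]. *)
have keyM m z : (0 < m)%N -> iter (m + p - 1) d z = B ^+ (p - 1) * iter m d z.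
  by case: m => // m _; rewrite addSn subn1 /= addnC iterD key.
split=> [|m m0|B0|B1]; split=> z _; rewrite ?key ?keyM //.
- by rewrite B0 expr0n subn_eq0 leqNgt prime_gt1 // mul0r.
- by rewrite B0 expr0n subn_eq0 leqNgt prime_gt1 // mul0r.
- by rewrite B1 expr1n mul1r.
- by rewrite B1 expr1n mul1r.
Qed.
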